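(* Let $r > 1$ be a real number. Then there exist a positive integer $\ell$ and pairwise disjoint closed intervals $I_1, \ldots, I_\ell \subseteq \mathbf{R}$ such that the topological closure of $\sigma_{-r}(\mathbf{N}^+)$ in $\mathbf{R}$ equals $I_1 \cup \cdots \cup I_\ell$. Furthermore, for each $k = 1, \ldots, \ell$, the set of positive integers $n$ such that $\sigma_{-r}(n) \in I_k$ has an asymptotic density $d_k$, and $d_k$ is a positive rational number.
   Context: $\mathbf{N}^+$ is the set of positive integers. For a real number $s$, the generalized divisor function is $\sigma_s(n) := \sum_{d \mid n} d^s$ for each positive integer $n$, where $d$ runs over all positive divisors of $n$; $\sigma_{-r}(\mathbf{N}^+) := \{\sigma_{-r}(n) : n \in \mathbf{N}^+\}$ denotes the image. The asymptotic density of a set $S \subseteq \mathbf{N}^+$ is $\lim_{x \to \infty} \frac{\#\{n \in S : n \leq x\}}{x}$, when this limit exists. *)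

(* Defs.v *)
From mathcomp Require Import all_boot all_order all_algebra.
From mathcomp Require Import finmap.
From mathcomp Require Import all_classical all_reals all_analysis.

Set Implicit Arguments.
Unset Strict Implicit.
Unset Printing Implicit Defensive.

Import Order.TTheory GRing.Theory Num.Theory.
Import numFieldNormedType.Exports.

Local Open Scope classical_set_scope.
Local Open Scope ring_scope.

Definition sigma (R : realType) (s : R) (n : nat) : R :=
  \sum_(d <- divisors n) d%:R `^ s.

Definition posnat : set nat := [set n | (0 < n)%N].

Definition count_upto (R : realType) (S : set nat) (x : R) : nat :=
  #|` fset_set (S `&` [set n | n%:R <= x])|%fset.

(* [fset_set] returns the empty set on infinite sets; this lemma shows that
   that convention is never triggered in [count_upto]. *)
Lemma finite_upto (R : realType) (S : set nat) (x : R) :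
  finite_set (S `&` [set n | n%:R <= x]).
Proof.
apply: sub_finite_set (finite_II (Num.truncn x).+1) => n [_ /= nx].
by rewrite ltnS -(natrK (R := R) n) le_truncn.
Qed.

Definition has_density (R : realType) (S : set nat) (d : R) : Prop :=
  (count_upto S x)%:R / x @[x --> +oo%R] --> d.

(* Main.v *)
(** Call an integer rough if all its prime factors exceed K.  By Chebyshev-type
    estimates the interval (q, 16 q] contains at least 16^r primes once q is large,
    so q^-r is at most the sum of p^-r over the primes p > q.  Hence, for K large
    and n rough, a greedy choice of prime powers, starting from the smallest prime,
    approximates every target between 1 and sigma(n) by values of sigma at rough
    integers.

    Take Q to be the K-smooth part of N!.  When N is large, the smooth part of n
    has almost the same sigma as d = gcd(n, Q), so the values of sigma on the
    class of n with gcd(n, Q) = d are dense in a nondegenerate segment starting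
    at sigma(d).  Finitely many segments, one for each d | Q, thus make up the
    closure, and the set of n with sigma(n) in a given component depends on
    gcd(n, Q) only; it is periodic, hence has a rational density. *)

Require Import Defs.
From mathcomp Require Import all_boot all_order all_algebra.
From mathcomp Require Import finmap zify ring lra.
From mathcomp Require Import all_classical all_reals all_analysis.

Set Implicit Arguments.
Unset Strict Implicit.
Unset Printing Implicit Defensive.

Import Order.TTheory GRing.Theory Num.Theory.
Import numFieldNormedType.Exports.

(** * Primes in (q, 16 q] *)

(** By Legendre's formula the exponent of p is the sum over k of floor(2n/p^k) - 2 floor(n/p^k).
    Each term is at most 1, and it vanishes once p^k > 2n. *)
Lemma pfactor_central_bin_le n p : 0 < n -> prime p ->
  p ^ logn p 'C(n.*2, n) <= n.*2.
Proof.
move=> n0 pp; have p1 := prime_gt1 pp.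
have n20 : 0 < n.*2 by rewrite double_gt0.
apply: leq_trans (trunc_logP p1 n20); rewrite leq_exp2l//.
have n2E : n.*2 - n = n by rewrite -addnn addnK.
have E : logn p (n.*2)`! = logn p 'C(n.*2, n) + (logn p n`!).*2.
  rewrite -(@bin_fact n.*2 n) ?n2E -?addnn ?leq_addr//.
  by rewrite addnn !lognM ?muln_gt0 ?fact_gt0 ?bin_gt0 -?addnn ?leq_addr// -addnn.
(* The sum for n! is prolonged by zero terms to the range of the sum for (2n)!, so that the two
   compare term by term. *)
have F : logn p n`! = \sum_(1 <= k < n.*2.+1) n %/ p ^ k.
  rewrite logn_fact// [RHS](@big_cat_nat _ _ _ n.+1)//=; last first.
    by rewrite ltnS -addnn leq_addr.
  rewrite [X in _ = (_ + X)%N]big_nat_cond [X in _ = (_ + X)%N]big1 ?addn0//.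
  move=> k /andP[/andP[nk _] _]; apply: divn_small.
  by apply: leq_ltn_trans (ltn_expl k p1); apply: ltnW.
set L := trunc_log p n.*2.
have LE : L <= n.*2.
  rewrite /L -(leq_exp2l _ _ p1); apply: leq_trans (trunc_logP p1 n20) _.
  exact/ltnW/ltn_expl.
have G : \sum_(1 <= k < n.*2.+1) (k <= L) = L.
  rewrite (@big_cat_nat _ _ _ L.+1)//= big_nat_cond.
  under eq_bigr => k /andP[/andP[_ kL] _] do rewrite -ltnS kL.
  rewrite -big_nat_cond sum_nat_const_nat subn1 muln1 /=.
  rewrite big_nat_cond big1 ?addn0// => k /andP[/andP[kL _] _].
  by rewrite leqNgt kL.
rewrite -(leq_add2r (logn p n`!).*2) -E logn_fact// -[X in _ <= X + _]G F.
rewrite -[X in _ <= _ + X]mul2n big_distrr /= -big_split/= big_nat_cond [leqRHS]big_nat_cond.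
apply: leq_sum => k /andP[/andP[k1 kn] _].
case: (leqP k L) => [kL|Lk] /=.
  have pk0 : 0 < p ^ k by rewrite expn_gt0 prime_gt0.
  rewrite -ltnS ltn_divLR// -addSn mulnDl.
  have := divn_eq n (p ^ k); have := ltn_pmod n pk0.
  move: (p ^ k) (n %/ _) (n %% _) => a b c; nia.
rewrite divn_small// ltnNge; apply: contraL Lk => pk.
by rewrite -leqNgt trunc_log_max.
Qed.

Lemma bin_le_exp2 n m : 'C(n, m) <= 2 ^ n.
Proof.
case: (leqP m n) => [mn|nm]; last by rewrite bin_small.
rewrite -[2]/(1 + 1) expnDn.
rewrite (bigD1 (Ordinal (mn : m < n.+1)))//= !exp1n !muln1; exact: leq_addr.
Qed.

Lemma exp2_le_central_bin n : 2 ^ n <= 'C(n.*2, n).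
Proof.
elim: n => [|n IH]; first by rewrite bin0.
have := mul_bin_diag n.*2.+2 n; have := mul_bin_down n.*2.+1 n.
have -> : n.*2.+1 - n = n.+1 by lia.
rewrite doubleS expnS /= => H1 H2.
suff : n.+1 * (2 * 2 ^ n) <= n.+1 * 'C(n.*2.+2, n.+1) by rewrite leq_pmul2l.
rewrite -H2; move: IH H1.
by move: ('C(_, _)) ('C(_, _)) (2 ^ n) => a b c; nia.
Qed.

Lemma prime_dvd_fact n p : prime p -> (p %| n`!) = (p <= n).
Proof.
move=> pp; apply/idP/idP => [|pn]; last by rewrite dvdn_fact// prime_gt0.
elim: n => [|n IH]; first by rewrite dvdn1 => /eqP p1; rewrite p1 in pp.
rewrite factS Euclid_dvdM// => /orP[/dvdn_leq->//|/IH pn].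
exact: leq_trans pn _.
Qed.

(** The primes in (2^k, 2^(k+1)] all divide C(2^(k+1), 2^k), which is at most 2^(2^(k+1)); the
    exponents of the dyadic blocks add up geometrically. *)
Lemma primorial_exp2_le k :
  \prod_(1 <= p < (2 ^ k).+1 | prime p) p <= 2 ^ (2 ^ k.+1).
Proof.
elim: k => [|k IH]; first by rewrite big_ltn_cond// big_geq.
have lekS : (2 ^ k).+1 <= (2 ^ k.+1).+1 by rewrite ltnS leq_exp2l.
rewrite (@big_cat_nat _ _ _ (2 ^ k).+1)//=.
rewrite [X in _ <= 2 ^ X]expnS mul2n -addnn expnD leq_mul//.
apply: leq_trans (bin_le_exp2 _ (2 ^ k)).
apply: dvdn_leq; first by rewrite bin_gt0 leq_exp2l.
set C := 'C(_, _).
have H p : prime p -> 2 ^ k < p <= 2 ^ k.+1 -> p %| C.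
  move=> pp /andP[kp pk].
  have : p %| (2 ^ k.+1)`! by rewrite dvdn_fact// prime_gt0.
  have kS : 2 ^ k.+1 - 2 ^ k = 2 ^ k by rewrite expnS mul2n -addnn addnK.
  rewrite -(@bin_fact (2 ^ k.+1) (2 ^ k)) ?leq_exp2l// kS.
  rewrite !Euclid_dvdM// -/C => /orP[//|].
  by rewrite orbb (prime_dvd_fact _ pp) leqNgt kp.
move: C H => C H.
(* Each new prime m is coprime to the product of the smaller ones, so divisibility accumulates. *)
have : forall m, m <= (2 ^ k.+1).+1 -> \prod_((2 ^ k).+1 <= p < m | prime p) p %| C.
  elim=> [_|m IHm mk]; first by rewrite big_geq// dvd1n.
  case: (leqP (2 ^ k).+1 m) => km; last by rewrite big_geq// dvd1n.
  rewrite big_mkcond big_nat_recr//= -big_mkcond/=.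
  case: ifP => pm; last by rewrite muln1 IHm// ltnW.
  rewrite Gauss_dvd; first by rewrite (IHm (ltnW mk)) (H m pm) ?km.
  rewrite coprime_sym prime_coprime// big_nat_cond.
  apply: (big_ind (fun x => ~~ (m %| x))).
  - by rewrite dvdn1 neq_ltn prime_gt1// orbT.
  - by move=> x y; rewrite Euclid_dvdM// negb_or => -> ->.
  - move=> p /andP[/andP[p1 pm'] pp]; rewrite dvdn_prime2//.
    by rewrite neq_ltn pm' orbT.
exact.
Qed.

Lemma exp2_gt_linear h : 10 <= h -> 32 * h < 2 ^ h.
Proof.
elim: h => // h IH; rewrite leq_eqVlt => /orP[/eqP <-//|]; rewrite ltnS => h9.
by move: (IH h9); rewrite expnS; lia.
Qed.

Lemma prod_const_count (I : Type) (s : seq I) (P : pred I) c :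
  \prod_(i <- s | P i) c = c ^ count P s.
Proof. by rewrite big_const_seq iter_muln_1. Qed.

(* In C(2^(j+3), 2^(j+2)) the prime powers p^v with p <= 2^h are at most 2^(j+3),
   the primes between 2^h and 2^j occur at most once, so their product is bounded by
   the primorial, and the size of the binomial forces many primes above 2^j. *)
Lemma many_primes_exp2 c : exists J, forall j, J <= j ->
  c <= count prime (index_iota (2 ^ j).+1 (2 ^ j.+3).+1).
Proof.
(* The summand c forces N < c <= j, hence N <= 2^h below; the 40 makes h large enough for
   [exp2_gt_linear]. *)
exists (c + 40) => j cj; rewrite leqNgt; apply/negP => Nc.
set N := count _ _ in Nc.
pose n := 2 ^ j.+2.
have n0 : 0 < n by rewrite expn_gt0.
have n2E : n.*2 = 2 ^ j.+3 by rewrite -mul2n -expnS.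
(* As 2h >= j + 3, a prime above 2^h has its square above 2n, hence exponent at most 1 in the
   central binomial. *)
pose h := (j + 4)./2.
have hj : j.+3 <= h.*2 by rewrite /h; lia.
set C := 'C(n.*2, n).
have C0 : 0 < C by rewrite bin_gt0 -addnn leq_addr.
have CE : C = \prod_(1 <= p < n.*2.+1 | prime p) p ^ logn p C.
  rewrite -[LHS]partnT// (@widen_partn (C + n.*2)) ?leq_addr//.
  have n2C : n.*2.+1 <= (C + n.*2).+1 by rewrite ltnS leq_addl.
  rewrite big_ltn// (@big_cat_nat _ _ _ n.*2.+1)//= lognE/= mul1n.
  rewrite [X in (_ * X)%N]big_nat_cond [X in (_ * X)%N]big1 ?muln1.
    rewrite [RHS]big_mkcond/=; apply: eq_bigr => p _.
    by case: ifP => // pp; rewrite lognE pp.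
  move=> p /andP[/andP[np _] _].
  have [pp|pp] := boolP (prime p); last by rewrite lognE (negPf pp).
  have := pfactor_central_bin_le n0 pp; rewrite -/C.
  case: (logn p C) => // k pk; suff : p < p by rewrite ltnn.
  apply: leq_ltn_trans np; apply: leq_trans pk.
  by rewrite expnS leq_pmulr// expn_gt0 prime_gt0.
have := exp2_le_central_bin n; rewrite -/C CE.
rewrite (@big_cat_nat _ _ _ (2 ^ j).+1)//=; last first.
  by rewrite n2E ltnS leq_exp2l// -addn3 leq_addr.
have B2 : \prod_((2 ^ j).+1 <= p < n.*2.+1 | prime p) p ^ logn p C <= (2 ^ j.+3) ^ N.
  rewrite /N -prod_const_count -n2E.
  by apply: leq_prod => p pp; apply: pfactor_central_bin_le.
have B1 : \prod_(1 <= p < (2 ^ j).+1 | prime p) p ^ logn p C <=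
    2 ^ (2 ^ j.+1) * (2 ^ j.+3) ^ (2 ^ h).
  apply: (@leq_trans (\prod_(1 <= p < (2 ^ j).+1 | prime p)
      (p * if p <= 2 ^ h then 2 ^ j.+3 else 1))).
    apply: leq_prod => p pp; have p1 := prime_gt1 pp.
    have := pfactor_central_bin_le n0 pp; rewrite -/C n2E.
    case: (leqP p (2 ^ h)) => [_ H|ph H].
      by apply: leq_trans H _; rewrite leq_pmull// prime_gt0.
    rewrite muln1 -[X in _ <= X]expn1 leq_exp2l// -ltnS.
    rewrite -(ltn_exp2l _ _ p1); apply: leq_ltn_trans H _.
    apply: leq_ltn_trans (_ : (2 ^ h) ^ 2 < _); last by rewrite ltn_exp2r.
    by rewrite -expnM leq_exp2l// muln2.
  rewrite big_split /= leq_mul ?primorial_exp2_le//.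
  rewrite -big_mkcondr /= prod_const_count leq_exp2l; last first.
    by rewrite -{1}(expn0 2) ltn_exp2l.
  rewrite -size_filter -[X in _ <= X](size_iota 1); apply: uniq_leq_size.
    by rewrite filter_uniq// iota_uniq.
  move=> p; rewrite mem_filter mem_index_iota mem_iota.
  by move=> /andP[/andP[_ ph] /andP[p1 _]]; rewrite p1 add1n ltnS.
move=> H; have {H} : 2 ^ n <= 2 ^ (2 ^ j.+1 + j.+3 * 2 ^ h + j.+3 * N).
  rewrite (expnD 2 (_ + _)) (expnD 2 (2 ^ _)) !(expnM 2 j.+3).
  by apply: leq_trans H _; apply: leq_mul.
rewrite leq_exp2l// /n.
have hj2 : h.*2 <= j + 4 by rewrite /h; lia.
have h10 : 10 <= h by lia.
have := exp2_gt_linear h10; rewrite (expnS 2 j.+1).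
have E1 : 2 ^ j.+1 = 2 ^ (j.+1 - h) * 2 ^ h by rewrite -expnD subnK//; lia.
have E2 : 2 ^ h <= 8 * 2 ^ (j.+1 - h).
  have hE : h <= 3 + (j.+1 - h) by lia.
  by rewrite -(expnD 2 3) leq_exp2l.
rewrite E1; have : 0 < 2 ^ h by rewrite expn_gt0.
(* With X = 2^(j+1-h) and Y = 2^h the exponents satisfy 2XY <= XY + (j+3)Y + (j+3)N. As N <= Y, this
   gives X <= 2(j+3) <= 4h, against 32h < Y <= 8X. *)
move: E2; move: (2 ^ (j.+1 - h)) (2 ^ h) => X Y YX Y0 hY.
have NY : N <= Y by lia.
rewrite mul2n -addnn -addnA leq_add2l => XY.
have : X * Y <= (2 * j.+3) * Y.
  by apply: leq_trans XY _; rewrite mul2n -addnn mulnDl leq_add2l leq_mul2l NY orbT.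
rewrite leq_pmul2r// => XJ; lia.
Qed.

(** If 2^i <= q < 2^(i+1), then (2^(i+1), 2^(i+4)] lies inside (q, 16q]; this is where the factor 16
    comes from. *)
Lemma many_primes c : exists K, forall q, K <= q ->
  c <= count prime (index_iota q.+1 (16 * q).+1).
Proof.
have [J HJ] := many_primes_exp2 c; exists (2 ^ J) => q Jq.
have q0 : 0 < q by apply: leq_trans Jq; rewrite expn_gt0.
set j := (trunc_log 2 q).+1.
have /andP[jq qj] : 2 ^ trunc_log 2 q <= q < 2 ^ j by exact: trunc_log_bounds.
have Jj : J <= j by rewrite ltnW// ltnS trunc_log_max.
apply: leq_trans (HJ j Jj) _; rewrite -!size_filter; apply: uniq_leq_size.
  by rewrite filter_uniq// iota_uniq.
move=> p; rewrite !mem_filter !mem_index_iota => /andP[-> /andP[jp pj]] /=.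
rewrite (leq_trans qj (ltnW jp)) /= (leq_trans pj)// ltnS.
have -> : 2 ^ j.+3 = 16 * 2 ^ trunc_log 2 q by rewrite !expnS !mulnA.
by rewrite leq_mul2l.
Qed.

Local Open Scope classical_set_scope.
Local Open Scope ring_scope.

(** * The divisor function on rough and smooth integers *)

Lemma ler_sum_uniq_sub (R : numDomainType) (I : eqType) (F : I -> R) (s1 s2 : seq I) :
  (forall i, 0 <= F i) -> uniq s1 -> {subset s1 <= s2} ->
  \sum_(i <- s1) F i <= \sum_(i <- s2) F i.
Proof.
move=> F0; elim: s1 s2 => [|x s1 IH] s2; first by rewrite big_nil sumr_ge0.
move=> /= /andP[xs1 us1] sub; have xs2 : x \in s2 by rewrite sub// mem_head.
rewrite (perm_big _ (perm_to_rem xs2)) !big_cons lerD2l IH// => y ys1.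
have := sub y; rewrite inE ys1 orbT => /(_ isT).
rewrite (perm_mem (perm_to_rem xs2)) inE => /orP[/eqP yx|//].
by rewrite -yx ys1 in xs1.
Qed.

Lemma sigma1 (R : realType) (s : R) : sigma s 1 = 1.
Proof. by rewrite /sigma big_seq1 powR1. Qed.

Lemma sigma_le_dvd (R : realType) (s : R) m n :
  (0 < n)%N -> (m %| n)%N -> sigma s m <= sigma s n.
Proof.
move=> n0 mn; apply: ler_sum_uniq_sub; first by move=> i; exact: powR_ge0.
  exact: divisors_uniq.
move=> d; rewrite -!dvdn_divisors// ?(dvdn_gt0 n0)// => dm.
exact: dvdn_trans mn.
Qed.

Lemma sigma_ge1 (R : realType) (s : R) n : (0 < n)%N -> 1 <= sigma s n.
Proof. by move=> n0; rewrite -(sigma1 s) sigma_le_dvd// dvd1n. Qed.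

Lemma sigma_gt0 (R : realType) (s : R) n : (0 < n)%N -> 0 < sigma s n.
Proof. by move=> /(sigma_ge1 s); exact: lt_le_trans. Qed.

Lemma perm_divisors_coprimeM m n : (0 < m)%N -> (0 < n)%N -> coprime m n ->
  perm_eq (divisors (m * n)) [seq (a * b)%N | a <- divisors m, b <- divisors n].
Proof.
move=> m0 n0 mn; have mn0 : (0 < m * n)%N by rewrite muln_gt0 m0.
apply: uniq_perm; first exact: divisors_uniq.
  apply: allpairs_uniq; try exact: divisors_uniq.
  (* The factor a is recovered from ab as its gcd with m, whence injectivity. *)
  have K a b : (a %| m)%N -> (b %| n)%N -> (gcdn (a * b) m = a)%N.
    move=> am bn; rewrite gcdnC Gauss_gcdl; first exact/gcdn_idPr.
    by rewrite (coprime_dvdr bn).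
  move=> [a b] [a' b'] /allpairsP[[x y] /= [+ + [-> ->]]] /allpairsP[[x' y'] /= [+ + [-> ->]]] E.
  rewrite -!dvdn_divisors// => xm yn xm' yn'.
  have Ex : x = x' by rewrite -(K x y)// E K.
  rewrite Ex; congr (_, _); apply/eqP.
  by rewrite -(@eqn_pmul2l x') ?(dvdn_gt0 m0)// -{1}Ex E.
move=> d; rewrite -dvdn_divisors//; apply/idP/allpairsP => [dmn|[[a b] /= [+ + ->]]].
  exists (gcdn d m, gcdn d n); rewrite /= -!dvdn_divisors// !dvdn_gcdr; split=> //.
  apply/eqP; rewrite eqn_dvd Gauss_dvd ?dvdn_gcdl ?andbT; last first.
    by rewrite (coprime_dvdl (dvdn_gcdr _ _))// (coprime_dvdr (dvdn_gcdr _ _)).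
  by rewrite muln_gcdr dvdn_gcd dvdn_mull//= muln_gcdl dvdn_gcd dvdn_mulr.
by rewrite -!dvdn_divisors//; exact: dvdn_mul.
Qed.

Lemma sigma_coprimeM (R : realType) (s : R) m n :
  (0 < m)%N -> (0 < n)%N -> coprime m n -> sigma s (m * n) = sigma s m * sigma s n.
Proof.
move=> m0 n0 mn; rewrite /sigma (perm_big _ (perm_divisors_coprimeM m0 n0 mn)).
rewrite big_allpairs_dep mulr_suml; apply: eq_bigr => a _.
by rewrite mulr_sumr; apply: eq_bigr => b _; rewrite natrM powRM.
Qed.

(** A divisor of pn either divides n or is p times a divisor of n. This bounds the jump of [sigma]
    when one exponent is raised by 1. *)
Lemma sigma_primeM_le (R : realType) (s : R) p n : prime p -> (0 < n)%N ->
  sigma s (p * n) <= (1 + p%:R `^ s) * sigma s n.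
Proof.
move=> pp n0; have p0 := prime_gt0 pp.
rewrite mulrDl mul1r /sigma mulr_sumr.
under [X in _ + X]eq_bigr => d _ do rewrite -powRM// -natrM.
rewrite -(big_map (muln p) xpredT (fun d => d%:R `^ s)) -big_cat.
apply: ler_sum_uniq_sub; first by move=> i; exact: powR_ge0.
  exact: divisors_uniq.
move=> d; rewrite -dvdn_divisors ?muln_gt0 ?p0// mem_cat -dvdn_divisors//.
have [pd dpn|pd dpn] := boolP (p %| d)%N; last first.
  by rewrite -(@Gauss_dvdr d p n) ?dpn// coprime_sym prime_coprime.
have [e de] := dvdnP pd; apply/orP; right; apply/mapP; exists e.
  by rewrite -dvdn_divisors// -(dvdn_pmul2l p0) -[X in (X %| _)%N]mulnC -de.
by rewrite de mulnC.
Qed.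

Lemma powRN_nat_anti (R : realType) (r : R) m n : 0 <= r -> (0 < m)%N -> (m <= n)%N ->
  n%:R `^ (- r) <= m%:R `^ (- r).
Proof.
move=> r0 m0 mn; rewrite !powRN lef_pV2 ?posrE ?powR_gt0 ?ltr0n//.
  by rewrite ge0_ler_powR ?nnegrE ?ler_nat.
exact: leq_trans mn.
Qed.

(** Cauchy condensation: the block [2^k, 2^(k+1)) contributes at most a^k with a = 2^(1-r) < 1.
    Arbitrary duplicate-free lists are allowed because the bound is applied to lists of divisors. *)
Lemma sum_powRN_tail (R : realType) (r e : R) : 1 < r -> 0 < e ->
  exists N, forall s : seq nat, uniq s -> all (leq N) s -> \sum_(d <- s) d%:R `^ (- r) <= e.
Proof.
move=> r1 e0; have r0 : 0 <= r by lra.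
pose F (d : nat) : R := d%:R `^ (- r).
pose a : R := 2 `^ (1 - r).
have a0 : 0 < a by rewrite powR_gt0.
have a1 : a < 1.
  rewrite /a /powR pnatr_eq0 /= -[ltRHS]expR0 ltr_expR.
  by rewrite nmulr_rlt0 ?subr_lt0// ln_gt0 ?ltr1n.
have blk k : \sum_(2 ^ k <= d < 2 ^ k.+1) F d <= a ^+ k.
  apply: (@le_trans _ _ (\sum_(2 ^ k <= d < 2 ^ k.+1) F (2 ^ k)%N)).
    apply: ler_sum_nat => d /andP[kd _]; apply: powRN_nat_anti => //.
    by rewrite expn_gt0.
  rewrite big_const_nat iter_addr_0 expnS mul2n -addnn addnK -mulr_natl.
  have -> : a = 2 * 2 `^ (- r).
    by rewrite /a powRD ?powRr1// pnatr_eq0 implybT.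
  by rewrite /F natrX exprMn -[(2 `^ _) ^+ k]powR_mulrn ?powR_ge0// powRAC powR_mulrn.
(* The geometric sum in telescoped form, multiplied by 1 - a to avoid a division. *)
have dyadic k j : (1 - a) * \sum_(2 ^ k <= d < 2 ^ (k + j)) F d <= a ^+ k - a ^+ (k + j).
  elim: j => [|j IH]; first by rewrite addn0 big_geq// mulr0 subrr.
  rewrite (@big_cat_nat _ _ _ (2 ^ (k + j)))//= ?leq_exp2l ?leq_addr ?leq_add2l//.
  rewrite addnS; have := blk (k + j)%N; rewrite -(ler_pM2l (_ : 0 < 1 - a)) ?subr_gt0//.
  rewrite exprS; move: (\sum_(_ <= d < _) _) (\sum_(_ <= d < _) _) IH => A B; lra.
have [k ak] : exists k, a ^+ k <= (1 - a) * e.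
  have : a ^+ n @[n --> \oo] --> (0 : R) by apply: cvg_expr; rewrite gtr0_norm.
  have ae : 0 < (1 - a) * e by rewrite mulr_gt0 ?subr_gt0.
  move=> /cvgrPdist_le /(_ _ ae) [k _ /(_ k (leqnn k))].
  by rewrite /= sub0r normrN gtr0_norm ?exprn_gt0//; exists k.
exists (2 ^ k)%N => s us ks.
rewrite -(ler_pM2l (_ : 0 < 1 - a)) ?subr_gt0//; apply: le_trans ak.
have [j sj] : exists j, all (fun d => d < 2 ^ (k + j))%N s.
  exists (\max_(d <- s) d); apply/allP => d ds.
  have dmax := @leq_bigmax_seq _ s xpredT (fun d => d) d ds isT; rewrite /= in dmax.
  apply: leq_ltn_trans dmax _; exact: leq_ltn_trans (leq_addl k _) (ltn_expl _ _).
apply: (@le_trans _ _ ((1 - a) * \sum_(2 ^ k <= d < 2 ^ (k + j)) F d)).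
  rewrite ler_pM2l ?subr_gt0//; apply: ler_sum_uniq_sub => // d ds.
  by rewrite mem_index_iota (allP ks)//= (allP sj).
apply: le_trans (dyadic k j) _; rewrite gerBl.
by rewrite exprn_ge0// ltW.
Qed.

Lemma sigma_ge_primes (R : realType) (s : R) n (l : seq nat) : (0 < n)%N ->
  uniq l -> all prime l -> all (dvdn^~ n) l ->
  1 + \sum_(p <- l) p%:R `^ s <= sigma s n.
Proof.
move=> n0 ul /allP pl /allP ln.
have -> : 1 + \sum_(p <- l) p%:R `^ s = \sum_(p <- 1%N :: l) p%:R `^ s :> R.
  by rewrite big_cons powR1.
apply: ler_sum_uniq_sub; first by move=> i; exact: powR_ge0.
  by rewrite /= ul andbT; apply/negP => /pl.
move=> d; rewrite inE -dvdn_divisors// => /orP[/eqP->|/ln//].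
exact: dvd1n.
Qed.

(** Being a [nat_pred], it gives access to pi-parts: [(above K).-nat] singles out the positive
    K-rough integers, and its complement the K-smooth ones. *)
Definition above (k : nat) : nat_pred := [pred p | (k < p)%N].

(** It lets the gap hypothesis of the greedy argument pass to n stripped of its least prime. *)
Lemma partn_above_partC_pdiv n q : (1 < n)%N -> (pdiv n <= q)%N ->
  (n`_((pdiv n)^')`_(above q) = n`_(above q))%N.
Proof.
move=> n1 nq; apply: partn_part => p; rewrite !inE => qp.
by rewrite neq_ltn (leq_ltn_trans nq qp) orbT.
Qed.

(* The exponent of the least prime is chosen maximal; the gap hypothesis says that
   the remaining quotient is within reach of the larger primes. *)
Lemma sigma_greedy (R : realType) (s D : R) n : (0 < n)%N -> 0 <= D ->
  (forall q, prime q -> (q %| n)%N ->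
     1 + q%:R `^ s <= (1 + D) * sigma s (n`_(above q))%N) ->
  forall y, 1 <= y -> y <= (1 + D) * sigma s n ->
  exists t, [/\ (t %| n)%N, sigma s t <= y & y <= (1 + D) * sigma s t].
Proof.
move=> + D0; elim/ltn_ind: n => n IH n0 gap y y1 yn.
have [n1|n1] := leqP n 1.
  have nE : n = 1%N by apply/eqP; rewrite eqn_leq n1.
  move: yn; rewrite nE => yn.
  by exists 1%N; rewrite dvd1n {1}sigma1.
set q := pdiv n; have pq : prime q := pdiv_prime n1.
have q0 := prime_gt0 pq; have qn : (q %| n)%N := pdiv_dvd n.
pose V := logn q n; pose m := (n`_(q^'))%N.
have m0 : (0 < m)%N := part_gt0 _ _.
have nE : n = (q ^ V * m)%N by rewrite -[LHS](partnC q n0) p_part.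
have qX k : (0 < q ^ k)%N by rewrite expn_gt0 q0.
have qm k : coprime (q ^ k) m.
  by apply: (@pnat_coprime q); [rewrite pnatX pnat_id | exact: part_pnat].
have m_lt : (m < n)%N.
  by rewrite nE ltn_Pmull// -(expn0 q) ltn_exp2l ?prime_gt1// logn_gt0 mem_primes pq n0.
pose P v := (v <= V)%N && (sigma s (q ^ v) <= y).
have P0 : exists v, P v by exists 0%N; rewrite /P /= sigma1.
have PV v : P v -> (v <= V)%N by case/andP.
case: (ex_maxnP P0 PV) => v /andP[vV vy] vmax.
have gv0 : 0 < sigma s (q ^ v) by apply: sigma_gt0.
have gapm p : prime p -> (p %| m)%N ->
    1 + p%:R `^ s <= (1 + D) * sigma s (m`_(above p))%N.
  move=> pp pm; have qp : (q <= p)%N.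
    by apply: pdiv_min_dvd (prime_gt1 pp) (dvdn_trans pm (dvdn_part _ _)).
  rewrite partn_above_partC_pdiv//; apply: gap => //.
  exact: dvdn_trans pm (dvdn_part _ _).
have [||t [tm ty yt]] := IH m m_lt m0 gapm (y / sigma s (q ^ v)).
- by rewrite ler_pdivlMr// mul1r.
- rewrite ler_pdivrMr//.
  have [vV'|] := eqVneq v V.
    move: yn; rewrite nE sigma_coprimeM// vV' => /le_trans; apply.
    by rewrite -mulrA [X in _ * X]mulrC.
  (* If v < V, maximality gives y < sigma(q^(v+1)) <= (1 + q^s) sigma(q^v). The gap hypothesis
     bounds 1 + q^s by (1 + D) sigma(m), since the part of n above q divides m. *)
  move=> vV'; have : (v < V)%N by rewrite ltn_neqAle vV'.
  move=> vltV; have : ~~ P v.+1.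
    by apply/negP => /vmax; rewrite ltnn.
  rewrite /P vltV /= -ltNge => /ltW /le_trans; apply.
  rewrite expnS; apply: le_trans (sigma_primeM_le _ pq (qX v)) _.
  rewrite ler_pM2r//; apply: le_trans (gap q pq qn) _.
  rewrite ler_wpM2l ?addr_ge0// sigma_le_dvd//.
  apply: sub_in_partn => p _; rewrite !inE => qp.
  by rewrite neq_ltn qp orbT.
exists (q ^ v * t)%N.
have qt : coprime (q ^ v) t by rewrite coprime_sym (coprime_dvdl tm)// coprime_sym.
have t0 : (0 < t)%N := dvdn_gt0 m0 tm.
rewrite sigma_coprimeM//; split.
- by rewrite nE dvdn_mul// dvdn_exp2l.
- by rewrite mulrC -ler_pdivlMr.
- by rewrite [X in _ * X]mulrC mulrA -ler_pdivrMr.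
Qed.

(** Each of the at least 16^r primes in (q, 16q] contributes at least (16q)^-r. *)
Lemma sum_primes_ge (R : realType) (r : R) c q : 0 <= r -> (0 < q)%N ->
  16 `^ r <= c%:R -> (c <= count prime (index_iota q.+1 (16 * q).+1))%N ->
  q%:R `^ (- r) <= \sum_(q.+1 <= p < (16 * q).+1 | prime p) p%:R `^ (- r).
Proof.
move=> r0 q0 rc cq.
apply: (@le_trans _ _ (\sum_(q.+1 <= p < (16 * q).+1 | prime p) (16 * q)%:R `^ (- r))).
  rewrite big_const_seq iter_addr_0 -[leRHS]mulr_natl natrM powRM// mulrA.
  rewrite ler_peMl ?powR_ge0// powRN ler_pdivlMr ?powR_gt0// mul1r.
  by apply: le_trans rc _; rewrite ler_nat.
rewrite big_nat_cond [leRHS]big_nat_cond; apply: ler_sum => p /andP[/andP[qp pq] pp].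
by apply: powRN_nat_anti; rewrite ?prime_gt0.
Qed.

(** The greedy lemma is applied with D = e to a multiple [n1] of n containing every prime in (K,
    16X], where X^-r <= e. A prime q >= X leaves a gap of at most e; for q < X the primes in (q,
    16q] divide [n1] and fill the gap. *)
Lemma sigma_rough_dense (R : realType) (r : R) c K : 1 < r -> 16 `^ r <= c%:R ->
  (forall q, (K <= q)%N -> (c <= count prime (index_iota q.+1 (16 * q).+1))%N) ->
  forall n (y e : R), (above K).-nat n -> 1 <= y -> y <= sigma (- r) n -> 0 < e ->
  exists t, [/\ (above K).-nat t, sigma (- r) t <= y & y <= (1 + e) * sigma (- r) t].
Proof.
move=> r1 rc cK n y e Kn y1 yn e0; have r0 : 0 <= r by lra.
have n0 : (0 < n)%N by case/andP: Kn.
pose X := (Num.truncn e^-1).+1.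
have Xe : X%:R `^ (- r) <= e.
  have eX : e^-1 < X%:R by apply: truncnS_gt.
  apply: (@le_trans _ _ (X%:R^-1)).
    by rewrite powRN lef_pV2 ?posrE ?powR_gt0// le1r_powR ?(ltW r1)// ler1n.
  by rewrite -[leRHS]invrK lef_pV2 ?posrE ?invr_gt0// ltW.
pose n1 := (n * ((16 * X)`!)`_(above K))%N.
have Kn1 : (above K).-nat n1 by rewrite pnatM Kn part_pnat.
have n10 : (0 < n1)%N by case/andP: Kn1.
have [q pq qn1||t [tn ty yt]] := @sigma_greedy R (- r) e n1 n10 (ltW e0) _ y y1; last first.
- exists t; split=> //; exact: pnat_dvd Kn1.
- apply: le_trans yn _; rewrite -[leLHS]mul1r ler_pM ?(ltW (sigma_gt0 _ _))//.
    by rewrite lerDl ltW.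
  by rewrite sigma_le_dvd// dvdn_mulr.
have Kq : (K < q)%N by have /pnatP := Kn1; apply.
have [Xq|qX] := leqP X q.
  apply: (@le_trans _ _ (1 + e)).
    by rewrite lerD2l; apply: le_trans Xe; apply: powRN_nat_anti.
  by rewrite ler_peMr ?sigma_ge1 ?part_gt0// addr_ge0 ?ltW.
pose L := [seq p <- index_iota q.+1 (16 * q).+1 | prime p].
apply: (@le_trans _ _ (1 + \sum_(p <- L) p%:R `^ (- r))).
  rewrite lerD2l big_filter; apply: (sum_primes_ge r0 (prime_gt0 pq) rc).
  by apply: cK; exact: ltnW.
apply: (@le_trans _ _ (sigma (- r) (n1`_(above q))%N)).
  apply: sigma_ge_primes; rewrite ?part_gt0 ?filter_uniq ?iota_uniq ?filter_all//.
  apply/allP => p; rewrite mem_filter mem_index_iota => /andP[pp /andP[qp pX]].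
  have pn : (p %| n1)%N.
    apply: dvdn_mull; rewrite -(part_pnat_id (pi := above K) (n := p)); last first.
      by rewrite pnatE// inE (ltn_trans Kq).
    apply: partn_dvd; rewrite ?fact_gt0// dvdn_fact// prime_gt0//=.
    by rewrite ltnS in pX; apply: leq_trans pX _; rewrite leq_mul2l ltnW ?orbT.
  rewrite -(part_pnat_id (pi := above q) (n := p)) ?partn_dvd//.
  by rewrite pnatE// inE.
by rewrite ler_peMl ?(ltW (sigma_gt0 _ _))// ?part_gt0// lerDl ltW.
Qed.

(** The divisors of m below N also divide gcd(m, Q); all the others belong to the tail. *)
Lemma sigma_le_part (R : realType) (s e : R) N Q m : (0 < m)%N -> (0 < Q)%N ->
  (forall l : seq nat, uniq l -> all (leq N) l -> \sum_(d <- l) d%:R `^ s <= e) ->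
  (forall d, (d %| m)%N -> (d < N)%N -> (d %| Q)%N) ->
  sigma s m <= sigma s (gcdn m Q) + e.
Proof.
move=> m0 Q0 tail small; rewrite {1}/sigma (bigID (fun d => d %| Q)%N)/=.
rewrite lerD// -big_filter.
  apply: ler_sum_uniq_sub; rewrite ?filter_uniq ?divisors_uniq//.
  move=> d; rewrite mem_filter -!dvdn_divisors// ?gcdn_gt0 ?m0//.
  by rewrite dvdn_gcd andbC.
apply: tail; first by rewrite filter_uniq ?divisors_uniq.
apply/allP => d; rewrite mem_filter -dvdn_divisors// => /andP[dQ dm].
by rewrite leqNgt; apply: contra dQ; exact: small.
Qed.

Lemma sigma_bounded (R : realType) (r : R) : 1 < r ->
  exists B, forall n, sigma (- r) n <= B.
Proof.
move=> r1; have [N tail] := sum_powRN_tail r1 ltr01.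
exists (\sum_(0 <= d < N) d%:R `^ (- r) + 1) => n.
rewrite /sigma (bigID (fun d => d < N)%N)/= lerD// -big_filter.
  apply: ler_sum_uniq_sub; rewrite ?filter_uniq ?divisors_uniq//.
  by move=> d; rewrite mem_filter mem_index_iota => /andP[].
apply: tail; first by rewrite filter_uniq ?divisors_uniq.
by apply/allP => d; rewrite mem_filter -leqNgt => /andP[].
Qed.

(** Multiplying by a K-rough integer does not change the gcd with Q, so each class inherits the
    density of the rough values, scaled by the value at a smooth integer. A fixed prime q > K gives
    every class a value above its least one sigma(d), and N is chosen so that the tail is at most
    q^-r. *)
Lemma sigma_gcd_classes (R : realType) (r : R) : 1 < r -> exists Q,
  [/\ (0 < Q)%N,
    forall d, (d %| Q)%N ->
      exists2 n, (0 < n)%N & gcdn n Q = d /\ sigma (- r) d < sigma (- r) n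
  & forall n (y e : R), (0 < n)%N -> sigma (- r) (gcdn n Q) <= y -> y <= sigma (- r) n ->
      0 < e -> exists n', [/\ (0 < n')%N, gcdn n' Q = gcdn n Q,
        sigma (- r) n' <= y & y <= (1 + e) * sigma (- r) n']].
Proof.
move=> r1.
pose c := (Num.truncn (16 `^ r)).+1.
have rc : 16 `^ r <= c%:R by rewrite ltW// truncnS_gt.
have [K cK] := many_primes c.
have dense := sigma_rough_dense r1 rc cK.
have [q Kq pq] := prime_above K.
have q0 := prime_gt0 pq.
have Kqn : (above K).-nat q by rewrite pnatE.
have sq : 1 + q%:R `^ (- r) <= sigma (- r) q.
  have := @sigma_ge_primes R (- r) q [:: q] q0.
  by rewrite /= pq dvdnn big_seq1; apply.
have e0 : 0 < q%:R `^ (- r) by rewrite powR_gt0 ?ltr0n.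
have [N tail] := sum_powRN_tail r1 e0.

pose Q := ((N`!)`_((above K)^'))%N.
have Q0 : (0 < Q)%N := part_gt0 _ _.
have KQ t : (above K).-nat t -> coprime t Q.
  by move=> Kt; apply: pnat_coprime Kt (part_pnat _ _).
have gcdM m t : (above K).-nat t -> gcdn (m * t) Q = gcdn m Q.
  by move=> /KQ tQ; rewrite ![gcdn _ Q]gcdnC Gauss_gcdl// coprime_sym.
have lift m y n e : (0 < m)%N -> (forall t, (above K).-nat t -> coprime m t) ->
    sigma (- r) m <= y -> (above K).-nat n -> y <= sigma (- r) m * sigma (- r) n -> 0 < e ->
    exists n', [/\ (0 < n')%N, gcdn n' Q = gcdn m Q,
        sigma (- r) n' <= y & y <= (1 + e) * sigma (- r) n'].
  move=> m0 mK my Kn ymn e_gt0; have gm0 := sigma_gt0 (- r) m0.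
  have [||t [Kt ty yt]] := dense n (y / sigma (- r) m) e Kn _ _ e_gt0.
  - by rewrite ler_pdivlMr// mul1r.
  - by rewrite ler_pdivrMr// mulrC.
  have t0 : (0 < t)%N by case/andP: Kt.
  exists (m * t)%N; rewrite muln_gt0 m0 t0 gcdM//; split=> //.
    by rewrite sigma_coprimeM ?mK// mulrC -ler_pdivlMr.
  by rewrite sigma_coprimeM ?mK// [X in _ * X]mulrC mulrA -ler_pdivrMr.
have QK d : (d %| Q)%N -> forall t, (above K).-nat t -> coprime d t.
  by move=> dQ t /KQ; rewrite coprime_sym => /(coprime_dvdl dQ).
exists Q; split=> //.
  move=> d dQ; have d0 := dvdn_gt0 Q0 dQ.
  exists (d * q)%N; first by rewrite muln_gt0 d0.
  rewrite gcdM//; split; first exact/gcdn_idPl.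
  rewrite sigma_coprimeM ?QK// ltr_pMr ?sigma_gt0//.
  by apply: lt_le_trans sq; rewrite ltrDl.
move=> n y e n0 dy yn e_gt0.
pose m := (n`_((above K)^'))%N; pose t := (n`_(above K))%N.
have m0 : (0 < m)%N := part_gt0 _ _.
have nE : n = (m * t)%N by rewrite mulnC partnC.
have Kt : (above K).-nat t := part_pnat _ _.
have mK s : (above K).-nat s -> coprime m s.
  by move=> Ks; rewrite coprime_sym; apply: pnat_coprime Ks (part_pnat _ _).
have dE : gcdn n Q = gcdn m Q by rewrite nE gcdM.
(* If y >= sigma(m), rough multiples of the smooth part m reach y. Otherwise rough multiples of d =
   gcd(m, Q) do, because sigma(m) <= sigma(d) + q^-r <= sigma(d) sigma(q). *)
rewrite dE; have [my|/ltW ym] := leP (sigma (- r) m) y.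
  by apply: (lift m y t) => //; rewrite -sigma_coprimeM ?mK -?nE// part_gt0.
have d0 : (0 < gcdn m Q)%N by rewrite gcdn_gt0 m0.
have := lift (gcdn m Q) y q e d0 (QK _ (dvdn_gcdr _ _)).
rewrite (_ : gcdn (gcdn m Q) Q = gcdn m Q); last by apply/gcdn_idPl; exact: dvdn_gcdr.
apply=> //; first by rewrite -dE.
apply: le_trans ym _.
apply: le_trans (sigma_le_part m0 Q0 tail _) _.
  move=> d dm dN; have d1 := dvdn_gt0 m0 dm.
  rewrite -(part_pnat_id (pi := ((above K)^')%N) (n := d)); last exact: pnat_dvd dm (part_pnat _ _).
  by rewrite partn_dvd ?fact_gt0// dvdn_fact// d1 ltnW.
have g1 := sigma_ge1 (- r) d0; nra.
Qed.

(** * Disjoint decomposition of a finite union of segments *)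

Definition seg_proper (R : realDomainType) (p : R * R) := p.1 < p.2.
Definition seg_mem (R : realDomainType) (x : R) (p : R * R) := p.1 <= x <= p.2.
Definition seg_sub (R : realDomainType) (p q : R * R) := (q.1 <= p.1) && (p.2 <= q.2).
Definition seg_meet (R : realDomainType) (p q : R * R) := (p.1 <= q.2) && (q.1 <= p.2).
Definition seg_hull (R : realDomainType) (p q : R * R) : R * R :=
  (Num.min p.1 q.1, Num.max p.2 q.2).

(** Inserts p into a list, absorbing the segments it meets. For a pairwise disjoint list one pass
    suffices, even though p grows on the way. *)
Fixpoint seg_merge (R : realDomainType) (p : R * R) (s : seq (R * R)) : seq (R * R) :=
  if s is q :: s' then
    if seg_meet p q then seg_merge (seg_hull p q) s' else q :: seg_merge p s'
  else [:: p].

Lemma seg_meetP (R : realDomainType) (p q : R * R) : p.1 < p.2 -> q.1 < q.2 ->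
  reflect (exists2 x, seg_mem x p & seg_mem x q) (seg_meet p q).
Proof.
move=> p12 q12; rewrite /seg_meet /seg_mem; apply: (iffP idP).
  move=> /andP[pq qp]; exists (Num.max p.1 q.1).
    by rewrite le_max lexx ge_max (ltW p12) qp.
  by rewrite le_max lexx orbT ge_max pq ltW.
by move=> [x /andP[px xp] /andP[qx xq]]; rewrite (le_trans px)//= (le_trans qx).
Qed.

Lemma seg_mem_hull (R : realDomainType) (x : R) (p q : R * R) : seg_meet p q ->
  seg_mem x (seg_hull p q) = seg_mem x p || seg_mem x q.
Proof.
move=> /andP[pq qp]; rewrite /seg_mem /seg_hull /= ge_min le_max.
apply/idP/idP; last by case/orP => /andP[-> ->]; rewrite ?orbT.
move=> /andP[/orP[] h1 /orP[] h2].
- by rewrite h1 h2.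
- by rewrite h1 h2; case: (leP x p.2) => //= /ltW xp; rewrite (le_trans qp).
- by rewrite h1 h2 andbT orbC; case: (leP x q.2) => //= /ltW xq; rewrite (le_trans pq).
- by rewrite h1 h2 orbT.
Qed.

Lemma seg_subP (R : realDomainType) (x : R) (p q : R * R) :
  seg_sub p q -> seg_mem x p -> seg_mem x q.
Proof.
by move=> /andP[qp pq] /andP[px xp]; rewrite /seg_mem (le_trans qp)//= (le_trans xp).
Qed.

Lemma seg_sub_trans (R : realDomainType) : transitive (@seg_sub R).
Proof.
move=> q p s /andP[qp pq] /andP[sq qs].
by rewrite /seg_sub (le_trans sq)//= (le_trans pq).
Qed.

Lemma seg_sub_hull (R : realDomainType) (p q : R * R) :
  seg_sub p (seg_hull p q) && seg_sub q (seg_hull p q).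
Proof. by rewrite /seg_sub /= !ge_min !le_max !lexx !orbT. Qed.

Lemma seg_hull_proper (R : realDomainType) (p q : R * R) :
  seg_proper p -> seg_proper (seg_hull p q).
Proof. by rewrite /seg_proper /= gt_min !lt_max => ->. Qed.

Lemma seg_merge_proper (R : realDomainType) (p : R * R) s :
  seg_proper p -> all (@seg_proper R) s -> all (@seg_proper R) (seg_merge p s).
Proof.
elim: s p => [|q s IH] p pp /=; first by rewrite pp.
move=> /andP[qp sp]; case: ifP => _ /=; last by rewrite qp IH.
by apply: IH => //; exact: seg_hull_proper.
Qed.

Lemma has_seg_merge (R : realDomainType) (x : R) p s :
  has (seg_mem x) (seg_merge p s) = seg_mem x p || has (seg_mem x) s.
Proof.
elim: s p => [|q s IH] p //=; case: ifP => pq /=; first by rewrite IH seg_mem_hull// orbA.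
by rewrite IH orbCA.
Qed.

(** Merging only forms unions of meeting segments, so a segment q disjoint from p and from all of s
    stays disjoint from the result. *)
Lemma seg_merge_pairwise (R : realDomainType) (p : R * R) s :
  seg_proper p -> all (@seg_proper R) s ->
  pairwise (fun p q => ~~ seg_meet p q) s ->
  pairwise (fun p q => ~~ seg_meet p q) (seg_merge p s).
Proof.
elim: s p => [|q s IH] p pp //= /andP[qp sp] /andP[/allP qs ps].
case: ifPn => [_|pq /=]; first by apply: IH => //; exact: seg_hull_proper.
rewrite IH// andbT; apply/allP => z zs; apply/seg_meetP => //.
  exact: (allP (seg_merge_proper pp sp)).
move=> [x xq xz]; have : has (seg_mem x) (seg_merge p s) by apply/hasP; exists z.
rewrite has_seg_merge => /orP[xp|/hasP[w ws xw]].
  by move/seg_meetP : pq; apply => //; exists x.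
have := qs _ ws; move/seg_meetP; apply=> //; last by exists x.
exact: (allP sp).
Qed.

Lemma seg_merge_sub_mono (R : realDomainType) (p : R * R) s q :
  q \in p :: s -> has (seg_sub q) (seg_merge p s).
Proof.
have refl (q' : R * R) : seg_sub q' q' by rewrite /seg_sub !lexx.
elim: s p q => [|w s IH] p q /=; first by rewrite inE => /eqP ->; rewrite refl.
have /andP[ph wh] := seg_sub_hull p w.
have H u : seg_sub u (seg_hull p w) -> has (seg_sub u) (seg_merge (seg_hull p w) s).
  move=> uh; have /hasP[z zs hz] := IH (seg_hull p w) _ (mem_head _ _).
  by apply/hasP; exists z => //; exact: seg_sub_trans hz.
rewrite !inE => /or3P[/eqP->|/eqP->|qs]; case: ifP => _ /=.
- exact: H.
- by rewrite IH ?mem_head ?orbT.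
- exact: H.
- by rewrite refl.
- by rewrite IH// inE qs orbT.
- by rewrite IH ?orbT// inE qs orbT.
Qed.

Lemma seg_merge_has_sub (R : realDomainType) (p z : R * R) s :
  z \in seg_merge p s -> has ((@seg_sub R)^~ z) (p :: s).
Proof.
elim: s p => [|w s IH] p /=.
  by rewrite inE => /eqP ->; rewrite /seg_sub !lexx.
case: ifP => _.
  move=> /IH /= /orP[hz|->]; last by rewrite !orbT.
  have /andP[ph _] := seg_sub_hull p w.
  by rewrite (seg_sub_trans ph hz).
rewrite inE => /orP[/eqP->|/IH /= /orP[->//|->]]; last by rewrite !orbT.
by rewrite {2}/seg_sub !lexx orbT.
Qed.

(** Of the last two clauses, the first will place sigma(n) and sigma(gcd(n, Q)) in the same
    component, and the second will make the densities positive. *)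
Lemma disjoint_segs (R : realDomainType) (s : seq (R * R)) :
  all (@seg_proper R) s -> exists t : seq (R * R),
  [/\ all (@seg_proper R) t, pairwise (fun p q => ~~ seg_meet p q) t,
      forall x, has (seg_mem x) t = has (seg_mem x) s,
      forall p, p \in s -> has (seg_sub p) t
    & forall q, q \in t -> has ((@seg_sub R)^~ q) s].
Proof.
elim: s => [|p s IH] /=; first by exists [::].
move=> /andP[pp /IH[t [tp pt tE st ts]]]; exists (seg_merge p t); split.
- exact: seg_merge_proper.
- exact: seg_merge_pairwise.
- by move=> x; rewrite has_seg_merge tE.
- move=> q; rewrite inE => /orP[/eqP->|/st/hasP[z zt qz]].
    exact: seg_merge_sub_mono (mem_head _ _).
  have /hasP[w wt zw] : has (seg_sub z) (seg_merge p t).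
    by apply: seg_merge_sub_mono; rewrite inE zt orbT.
  by apply/hasP; exists w => //; exact: seg_sub_trans zw.
- move=> q /seg_merge_has_sub /= /orP[->//|/hasP[z /ts/hasP[w ws wz] zq]].
  by apply/orP; right; apply/hasP; exists w => //; exact: seg_sub_trans zq.
Qed.

Lemma seg_pairwise_inj (R : realDomainType) (t : seq (R * R)) (x : R) i j :
  all (@seg_proper R) t -> pairwise (fun p q => ~~ seg_meet p q) t ->
  (i < size t)%N -> (j < size t)%N ->
  seg_mem x (nth (0, 0) t i) -> seg_mem x (nth (0, 0) t j) -> i = j.
Proof.
move=> /allP tp /(pairwiseP (0, 0)) pt.
wlog ij : i j / (i < j)%N => [H|] it jt xi xj.
  by have [ij|ji|//] := ltngtP i j; [exact: H|apply/esym; exact: H].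
have /negP := pt _ _ it jt ij; case; apply/seg_meetP.
- by apply: tp; rewrite mem_nth.
- by apply: tp; rewrite mem_nth.
- by exists x.
Qed.

Lemma closed_segs (R : realType) (s : seq (R * R)) : closed [set x | has (seg_mem x) s].
Proof.
elim: s => [|p s IH].
  by rewrite (_ : [set _ | _] = set0) ?predeqE//; exact: closed0.
rewrite (_ : [set _ | _] = `[p.1, p.2]%classic `|` [set x | has (seg_mem x) s]).
  by apply: closedU => //; exact: interval_closed.
by apply/seteqP; split => x /=; rewrite in_itv /= => /orP.
Qed.

(** * Densities of periodic sets *)

Lemma count_uptoE (R : realType) (P : pred nat) (x : R) : 0 <= x ->
  count_upto (posnat `&` [set n | P n]) x = count P (iota 1 (Num.truncn x)).
Proof.
move=> x0; rewrite /count_upto -size_filter.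
rewrite (_ : fset_set _ = [fset n in [seq n <- iota 1 (Num.truncn x) | P n]]%fset).
  by rewrite card_fseq undup_id// filter_uniq// iota_uniq.
apply/fsetP => n; rewrite in_fset_set; last exact: finite_upto.
rewrite !inE mem_filter mem_iota add1n ltnS truncn_ge_nat//.
by apply/idP/idP => [/set_mem[[] /= -> ->] -> //|/and3P[? ? ?]]; apply: mem_set.
Qed.

(** Sliding the window by one drops a and gains a + Q, on which P agrees. *)
Lemma count_iota_period (P : pred nat) Q a :
  (forall n, P (n + Q)%N = P n) -> count P (iota a Q) = count P (iota 0 Q).
Proof.
move=> PQ; elim: a => // a <-.
apply/eqP; rewrite -(eqn_add2l (P a)) -[X in X == _]/(count P (iota a Q.+1)).
by rewrite -addn1 iotaD count_cat /= PQ addn0 addnC.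
Qed.

Lemma count_iota_periodM (P : pred nat) Q a k :
  (forall n, P (n + Q)%N = P n) -> count P (iota a (k * Q)) = (k * count P (iota 0 Q))%N.
Proof.
move=> PQ; elim: k a => [|k IH] a //.
by rewrite !mulSn iotaD count_cat IH count_iota_period.
Qed.

Lemma periodic_has_density (R : realType) (P : pred nat) Q : (0 < Q)%N ->
  (forall n, P (n + Q)%N = P n) ->
  has_density (posnat `&` [set n | P n]) ((count P (iota 0 Q))%:R / Q%:R : R).
Proof.
move=> Q0 PQ; set c := count P (iota 0 Q); rewrite /has_density.
apply/cvgrPdist_le => e e0.
(* The error will be at most c/x; the extra 1 keeps x positive even if c = 0. *)
have : \forall x \near +oo, c%:R / e + 1 <= x :> R by apply: nbhs_pinfty_ge; exact: num_real.
apply: filterS => x xe.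
have ce0 : 0 <= c%:R / e by rewrite divr_ge0// ltW.
have x0 : 0 < x by lra.
rewrite (count_uptoE _ (ltW x0)); set m := Num.truncn x.
have /andP[mx xm] : m%:R <= x < m.+1%:R by apply: truncn_itv; exact: ltW.
set N := count P _; pose k := (m %/ Q)%N.
have kN : (k * c <= N)%N.
  rewrite -(count_iota_periodM 1 k PQ) /N (divn_eq m Q) iotaD count_cat.
  exact: leq_addr.
have Nk : (N <= k.+1 * c)%N.
  have mk : (m <= k.+1 * Q)%N by rewrite ltnW// -ltn_divLR.
  by rewrite -(count_iota_periodM 1 k.+1 PQ) -(subnKC mk) iotaD count_cat leq_addr.
have kQ : (k * Q <= m)%N by exact: leq_trunc_div.
have mkQ : (m.+1 <= k.+1 * Q)%N by rewrite -ltn_divLR.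
have Qr : 0 < Q%:R :> R by rewrite ltr0n.
have E : c%:R / Q%:R - N%:R / x = (c%:R * x - N%:R * Q%:R) / (Q%:R * x).
  by field; rewrite !gt_eqF.
rewrite E normrM normfV [X in _ / X]gtr0_norm ?mulr_gt0//.
rewrite ler_pdivrMr ?mulr_gt0//.
(* N lies between kc and (k+1)c, and x between kQ and (k+1)Q, so cx and NQ differ by at most cQ. *)
apply: (@le_trans _ _ (c%:R * Q%:R)); last first.
  rewrite [leRHS]mulrCA [leRHS]mulrC ler_pM2r// -ler_pdivrMl// mulrC; lra.
have kNr : k%:R * c%:R <= N%:R :> R by rewrite -natrM ler_nat.
have Nkr : N%:R <= (k%:R + 1) * c%:R :> R by rewrite natr1 -natrM ler_nat.
have kx : k%:R * Q%:R <= x by apply: le_trans mx; rewrite -natrM ler_nat.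
have xk : x <= (k%:R + 1) * Q%:R.
  by apply: le_trans (ltW xm) _; rewrite natr1 -natrM ler_nat.
have c0 : 0 <= c%:R :> R by [].
rewrite ler_norml; apply/andP; split; nra.
Qed.

(** * The closure of the image *)

Theorem theorem1p1 (R : realType) (r : R) (hr : 1 < r) :
  exists (l : nat) (a b : 'I_l -> R),
    [/\ (0 < l)%N,
        forall k, a k < b k,
        trivIset [set: 'I_l] (fun k => `[a k, b k]%classic),
        closure (sigma (- r) @` posnat) = \bigcup_(k in [set: 'I_l]) `[a k, b k]%classic
      & forall k, exists q : rat, 0 < q /\
          has_density (posnat `&` [set n | sigma (- r) n \in `[a k, b k]]) (ratr q : R)].
Proof.
have [Q [Q0 Qlt Qdense]] := sigma_gcd_classes hr.
have [B gB] := sigma_bounded hr.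
pose A d := [set sigma (- r) n | n in [set n | (0 < n)%N && (gcdn n Q == d)]].
have Aub d : has_ubound (A d) by exists B => _ [n _ <-]; exact: gB.
(* One segment per class: sigma(d) is its least value, and the supremum of the class is the right
   end. *)
pose s := [seq (sigma (- r) d, sup (A d)) | d <- divisors Q].
have mem_seg n : (0 < n)%N ->
    seg_mem (sigma (- r) n) (sigma (- r) (gcdn n Q), sup (A (gcdn n Q))).
  move=> n0; rewrite /seg_mem /= sigma_le_dvd ?dvdn_gcdl//=.
  by apply: ub_le_sup => //; exists n => //=; rewrite n0 eqxx.
have gcd_s n : (sigma (- r) (gcdn n Q), sup (A (gcdn n Q))) \in s.
  by apply/mapP; exists (gcdn n Q) => //; rewrite -dvdn_divisors// dvdn_gcdr.
have s_proper : all (@seg_proper R) s.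
  apply/allP => _ /mapP[d + ->]; rewrite -dvdn_divisors// => dQ.
  have [n n0 [nd dn]] := Qlt d dQ; apply: lt_le_trans dn _.
  by have /andP[_] := mem_seg n n0; rewrite nd.
have closE : closure (sigma (- r) @` posnat) = [set x | has (seg_mem x) s].
  apply/seteqP; split.
    rewrite [X in _ `<=` X](closure_id _).1; last exact: closed_segs.
    apply: closure_subset => _ [n n0 <-] /=; apply/hasP.
    by exists (sigma (- r) (gcdn n Q), sup (A (gcdn n Q))) => //; exact: mem_seg.
  move=> y /= /hasP[_ /mapP[d + ->]]; rewrite -dvdn_divisors// /seg_mem /= => dQ.
  have A0 : A d !=set0.
    have [n n0 [nd _]] := Qlt d dQ.
    by exists (sigma (- r) n), n => //=; rewrite n0 nd eqxx.
  (* The right end is a limit of values as a supremum. Below it, some sigma(n) of the class exceeds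
     y, so [Qdense] applies. *)
  move=> /andP[dy]; rewrite le_eqVlt => /orP[/eqP->|ytop].
    apply: closure_subset (closure_sup A0 (Aub d)) => _ [n /andP[n0 _] <-].
    by exists n.
  have [_ [n /andP[n0 /eqP nd] <-] yn] := sup_gt A0 ytop.
  have y0 : 0 < y by apply: lt_le_trans dy; rewrite sigma_gt0// (dvdn_gt0 Q0).
  move=> V /nbhs_ballP[e /= e0 eV].
  (* The relative error e/(2y) becomes an absolute error of at most e/2, since the approximating
     value is at most y. *)
  have e'0 : 0 < e / (2 * y) by rewrite divr_gt0// mulr_gt0.
  have [|n' [n'0 _ n'y yn']] := Qdense n y _ n0 _ (ltW yn) e'0; first by rewrite nd.
  exists (sigma (- r) n'); split; first by exists n'.
  apply: eV; rewrite /ball /= ger0_norm ?subr_ge0//.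
  have : e / (2 * y) * sigma (- r) n' <= e / (2 * y) * y by rewrite ler_pM2l.
  have -> : e / (2 * y) * y = e / 2 by field; rewrite gt_eqF.
  by move: yn'; rewrite mulrDl mul1r; move: (_ * _) => u; lra.
have [t [tp pt tE st ts]] := disjoint_segs s_proper.
pose I k := nth (0, 0) t k.
exists (size t), (fun k => (I k).1), (fun k => (I k).2); split.
- by have /hasP[p] := st _ (gcd_s 1%N); case: (t).
- by move=> k; apply: (allP tp); rewrite mem_nth.
- move=> i j _ _ [x [/= xi xj]]; apply/val_inj/(@seg_pairwise_inj _ t x) => //.
    by move: xi; rewrite in_itv /=.
  by move: xj; rewrite in_itv /=.
- rewrite closE; apply/seteqP; split=> x /=; rewrite -tE.
    move=> /(has_nthP (0, 0))[i it xi]; exists (Ordinal it) => //=.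
  by move=> [i _ /=]; rewrite in_itv /= => xi; apply/(has_nthP (0, 0)); exists i.
move=> k.
(* Testing gcd(n, Q) in place of n makes periodicity modulo Q evident. *)
pose P n := seg_mem (sigma (- r) (gcdn n Q)) (I k).
have PQ n : P (n + Q)%N = P n by rewrite /P ![gcdn _ Q]gcdnC gcdnDr.
exists ((count P (iota 0 Q))%:R / Q%:R); split.
  rewrite divr_gt0 ?ltr0n// -has_count; apply/hasP.
  have /hasP[_ /mapP[d + ->]] : has ((@seg_sub R)^~ (I k)) s by apply: ts; rewrite mem_nth.
  rewrite -dvdn_divisors// => dQ dk.
  have [n n0 [nd dn]] := Qlt d dQ.
  (* The component contains the segment of d, so the residue of d is counted. Reduction only affects
     d = Q, represented by 0, as gcd(0, Q) = Q. *)
  exists (d %% Q)%N; first by rewrite mem_iota ltn_mod.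
  rewrite /P gcdn_modl (gcdn_idPl dQ); apply: seg_subP dk _.
  have /andP[_] := mem_seg n n0; rewrite nd => ntop.
  by rewrite /seg_mem /= lexx (le_trans (ltW dn)).
rewrite fmorph_div /= !ratr_nat.
rewrite (_ : posnat `&` _ = posnat `&` [set n | P n]); first exact: periodic_has_density.
apply/seteqP.
(* Both sigma(n) and sigma(gcd(n, Q)) lie in the segment of gcd(n, Q), hence in one and the same
   component, numbered j below. *)
suff H n : (0 < n)%N -> seg_mem (sigma (- r) n) (I k) = P n.
  by split=> n [n0]; rewrite /= in_itv /= -/(seg_mem _ (I k)) H.
move=> n0; have /(has_nthP (0, 0))[j jt dj] := st _ (gcd_s n).
have nj := seg_subP dj (mem_seg n n0).
have gj : seg_mem (sigma (- r) (gcdn n Q)) (nth (0, 0) t j).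
  apply: seg_subP dj _; rewrite /seg_mem /= lexx /=.
  by have /andP[] := mem_seg n n0; exact: le_trans.
apply/idP/idP => [nk|nk].
  by rewrite /P /I -(seg_pairwise_inj tp pt jt (ltn_ord k) nj nk).
by rewrite /I -(seg_pairwise_inj tp pt jt (ltn_ord k) gj nk).
Qed.
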